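(* Fix a block $b$ and any $\omega_b\in\mathbb R$, $\lambda_b=(\lambda_{b,g})_{g\in\mathcal G}\ge0$ that are dual feasible for the block's fractional program, meaning $\omega_b-\sum_{g\ni i}\lambda_{b,g}\ge\mu_i$ for every arm $i$, and define the reduced cost $r_i=\omega_b-\mu_i-\sum_{g\ni i}\lambda_{b,g}\ge0$. Every blockwise-group-fair pull sequence satisfies $$V_b^{\mathrm{frac}}-\sum_{\tau\in\mathcal B_b}\mu_{A_\tau}\ \le\ \sum_{\tau\in\mathcal B_b}\Bigl[r_{A_\tau}+\sum_{g\ni A_\tau:\,d_g(\tau)=0}\lambda_{b,g}\Bigr],$$ with equality when $(\omega_b,\lambda_b)$ is dual optimal, in which case arms in the support of an optimal fractional plan have zero reduced cost. Every pull's contribution (each bracket on the right-hand side) is nonnegative.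
   Context: There are $K$ arms with means $\mu_i\in[0,1]$ and a collection $\mathcal G$ of groups (subsets of $[K]$, possibly overlapping). Block $b$ is a set $\mathcal B_b$ of $H_b$ consecutive rounds with integer group floors $f_{b,g}\ge0$; $A_\tau$ is the arm pulled at round $\tau$. A pull sequence is blockwise-group-fair if in block $b$ each group $g$ receives at least $f_{b,g}$ pulls of its arms. For $\tau\in\mathcal B_b$, $d_g(\tau)$ is group $g$'s remaining deficit in the block just before round $\tau$, i.e. $\max\{f_{b,g}-\#\{\tau'\in\mathcal B_b:\tau'<\tau,A_{\tau'}\in g\},0\}$. The block's fractional program is $V_b^{\mathrm{frac}}=\max\{\sum_i\mu_iy_i:\ y\ge0,\ \sum_{i\in g}y_i\ge f_{b,g}\ \forall g\in\mathcal G,\ \sum_iy_i=H_b\}$; an optimal fractional plan is a maximizer $y$. Its dual is to minimize $\omega_bH_b-\sum_gf_{b,g}\lambda_{b,g}$ over $\omega_b\in\mathbb R$, $\lambda_b\ge0$ with $\omega_b-\sum_{g\ni i}\lambda_{b,g}\ge\mu_i$ for all $i$; dual optimal means attaining this minimum. *)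

(* Defs.v *)
From mathcomp Require Import all_boot all_order all_algebra.
From mathcomp Require Import boolp classical_sets reals.
Set Implicit Arguments.
Unset Strict Implicit.
Unset Printing Implicit Defensive.
Import Order.TTheory GRing.Theory Num.Theory.
Local Open Scope ring_scope.

(* Only the floors of groups in the collection at hand are ever used. *)
Record block (K : nat) := Block {
  blk_start : nat;
  blk_len : nat;
  blk_floor : {set 'I_K} -> nat
}.

Definition rounds (K : nat) (b : block K) : seq nat :=
  index_iota (blk_start b) (blk_start b + blk_len b).

Definition blockwise_group_fair (K B : nat) (G : {set {set 'I_K}})
    (blk : 'I_B -> block K) (A : nat -> 'I_K) : Prop :=
  forall (b : 'I_B) (g : {set 'I_K}), g \in G ->
    (blk_floor (blk b) g <= count (fun t => A t \in g) (rounds (blk b)))%N.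

(* The truncated subtraction of nat is the max with 0 in the definition of
   the deficit. *)
Definition deficit (K : nat) (b : block K) (A : nat -> 'I_K)
    (g : {set 'I_K}) (tau : nat) : nat :=
  (blk_floor b g
     - count (fun t => (t < tau) && (A t \in g)) (rounds b))%N.

Definition frac_feasible (R : realType) (K : nat) (G : {set {set 'I_K}})
    (b : block K) (y : 'I_K -> R) : Prop :=
  [/\ forall i, 0 <= y i,
      forall g : {set 'I_K}, g \in G ->
        (blk_floor b g)%:R <= \sum_(i in g) y i
    & \sum_i y i = (blk_len b)%:R].

Definition frac_objective (R : realType) (K : nat) (mu y : 'I_K -> R) : R :=
  \sum_i mu i * y i.

Definition frac_optimal (R : realType) (K : nat) (mu : 'I_K -> R)
    (G : {set {set 'I_K}}) (b : block K) (y : 'I_K -> R) : Prop :=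
  frac_feasible G b y /\
  forall z : 'I_K -> R, frac_feasible G b z ->
    frac_objective mu z <= frac_objective mu y.

(* The greatest element of S; it is 0 by convention when S has none. *)
Definition set_max (R : realType) (S : set R) : R :=
  xget 0 (S `&` ubound S)%classic.

Definition frac_value (R : realType) (K : nat) (mu : 'I_K -> R)
    (G : {set {set 'I_K}}) (b : block K) : R :=
  set_max [set frac_objective mu y | y in [set y | frac_feasible G b y]]%classic.

Definition reduced_cost (R : realType) (K : nat) (mu : 'I_K -> R)
    (G : {set {set 'I_K}}) (omega : R) (lambda : {set 'I_K} -> R)
    (i : 'I_K) : R :=
  omega - mu i - \sum_(g in G | i \in g) lambda g.

Definition dual_feasible (R : realType) (K : nat) (mu : 'I_K -> R)
    (G : {set {set 'I_K}}) (omega : R) (lambda : {set 'I_K} -> R) : Prop :=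
  (forall g : {set 'I_K}, g \in G -> 0 <= lambda g) /\
  (forall i, mu i <= omega - \sum_(g in G | i \in g) lambda g).

Definition dual_objective (R : realType) (K : nat) (G : {set {set 'I_K}})
    (b : block K) (omega : R) (lambda : {set 'I_K} -> R) : R :=
  omega * (blk_len b)%:R - \sum_(g in G) (blk_floor b g)%:R * lambda g.

Definition dual_optimal (R : realType) (K : nat) (mu : 'I_K -> R)
    (G : {set {set 'I_K}}) (b : block K)
    (omega : R) (lambda : {set 'I_K} -> R) : Prop :=
  dual_feasible mu G omega lambda /\
  forall (omega' : R) (lambda' : {set 'I_K} -> R),
    dual_feasible mu G omega' lambda' ->
    dual_objective G b omega lambda <= dual_objective G b omega' lambda'.

Definition contribution (R : realType) (K : nat) (mu : 'I_K -> R)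
    (G : {set {set 'I_K}}) (b : block K) (omega : R)
    (lambda : {set 'I_K} -> R) (A : nat -> 'I_K) (tau : nat) : R :=
  reduced_cost mu G omega lambda (A tau)
  + \sum_(g in G | (A tau \in g) && (deficit b A g tau == 0%N)) lambda g.

(* Main.v *)
(* For a fair sequence, the collected means plus the contributions equal the
   dual objective exactly, so the statement compares the fractional value with
   the dual objective: weak duality gives the inequality, strong duality (from
   Farkas' lemma) the equality. If the fractional maximum were not attained,
   [frac_value] would be the junk value 0, still below the dual objective since
   the means are nonnegative. *)
Require Import Defs.
From mathcomp Require Import all_boot all_order all_algebra.
From mathcomp Require Import boolp classical_sets reals.
From mathcomp Require Import zify ring lra.
Import Order.TTheory GRing.Theory Num.Theory.
Local Open Scope ring_scope.


(** * Farkas' lemma for finitely many linear functionals *)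

Lemma scalar_fun0 (R : pzRingType) (V : lmodType R) (f : V -> R) :
  scalar f -> f 0 = 0.
Proof.
by move=> lin_f; have := lin_f (-1) 0 0; rewrite scaler0 addr0 mulN1r addNr.
Qed.

(* Induction on the number of functionals: if the constraint [j] is not
   redundant, some [x0] violating [c] has [a j x0 < 0], and projecting along
   [x0] onto the kernel of [a j] reduces to the remaining functionals. *)
Lemma farkas (R : realFieldType) (V : lmodType R) (I : eqType) (s : seq I)
    (a : I -> V -> R) (c : V -> R) :
    uniq s -> (forall i, scalar (a i)) -> scalar c ->
    (forall x, (forall i, i \in s -> 0 <= a i x) -> 0 <= c x) ->
  exists2 y : I -> R, forall i, 0 <= y i
                    & forall x, c x = \sum_(i <- s) y i * a i x.
Proof.
elim: s a c => [|j s IHs] a c.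
  move=> _ _ lin_c c_ge0; exists (fun=> 0) => // x; rewrite big_nil.
  have c0 := scalar_fun0 _ _ _ lin_c.
  (* With no constraint left, [c] is nonnegative at both [x] and [-x], hence zero. *)
  apply/eqP; rewrite eq_le c_ge0 // andbT -oppr_ge0.
  have := lin_c (-1) x 0; rewrite c0 !addr0 mulN1r => <-.
  exact: c_ge0.
move=> /= /andP[js us] lin_a lin_c c_ge0.
have [red|] := pselect (forall x, (forall i, i \in s -> 0 <= a i x) -> 0 <= c x).
  have [y y_ge0 cE] := IHs a c us lin_a lin_c red.
  exists (fun i => if i == j then 0 else y i) => [i|x]; first by case: ifP.
  rewrite big_cons eqxx mul0r add0r cE; apply: eq_big_seq => i si.
  by case: eqP => // ij; rewrite -ij si in js.
move=> /existsNP[x1 /not_implyP[ax1 /negP]]; rewrite -ltNge => cx1.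
have ajx1 : a j x1 < 0.
  rewrite ltNge; apply/negP => ajx1.
  suff : 0 <= c x1 by rewrite leNgt cx1.
  by apply: c_ge0 => i; rewrite inE => /predU1P[->|/ax1].
have linZ (f : V -> R) (lin_f : scalar f) k x : f (k *: x) = k * f x.
  by have := lin_f k x 0; rewrite scalar_fun0 // !addr0.
have linD (f : V -> R) (lin_f : scalar f) k x z : f (x + k *: z) = f x + k * f z.
  by rewrite addrC lin_f addrC.
(* The scaling gives [a j x0 = -1], so that [x + a j x *: x0] lies in the kernel of [a j]. *)
pose x0 := (- a j x1)^-1 *: x1.
have k_gt0 : 0 < (- a j x1)^-1 by rewrite invr_gt0 oppr_gt0.
have ax0 i : i \in s -> 0 <= a i x0.
  by move=> si; rewrite linZ // mulr_ge0 ?ax1 // ltW.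
have cx0 : c x0 < 0 by rewrite linZ // pmulr_rlt0.
have ajx0 : a j x0 = -1.
  by rewrite linZ // invrN mulNr mulVf // lt_eqF.
have lin_p (f : V -> R) : scalar f -> scalar (fun x => f (x + a j x *: x0)).
  by move=> lin_f k x z; rewrite !(linD _ lin_f) lin_f (lin_a j) /=; ring.
have [i||x ax|y y_ge0 cE] := IHs (fun i x => a i (x + a j x *: x0))
    (fun x => c (x + a j x *: x0)) us; [exact: lin_p | exact: lin_p | |].
  apply: c_ge0 => i; rewrite inE => /predU1P[->|/ax //].
  by rewrite linD // ajx0 mulrN1 subrr.
(* Expanding the identity for the projected functionals leaves [w] as the coefficient of [a j x];
   its sign comes from [a i x0 >= 0] and [c x0 < 0]. *)
pose w := \sum_(i <- s) y i * a i x0 - c x0.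
have w_ge0 : 0 <= w.
  rewrite subr_ge0 (le_trans (ltW cx0)) // big_seq.
  by apply: sumr_ge0 => i si; rewrite mulr_ge0 ?ax0.
exists (fun i => if i == j then w else y i) => [i|x]; first by case: ifP.
rewrite big_cons eqxx.
have -> : \sum_(i <- s) (if i == j then w else y i) * a i x
        = \sum_(i <- s) y i * a i x.
  apply: eq_big_seq => i si.
  by case: eqP => // ij; rewrite -ij si in js.
have := cE x; rewrite linD //.
under eq_bigr => i _ do rewrite linD // mulrDr mulrCA.
rewrite big_split /= -mulr_sumr => /eqP; rewrite -subr_eq => /eqP <-.
by rewrite /w; ring.
Qed.

(** * Counting the hits made before a floor is met *)

Lemma count_iota_ltn (P : pred nat) (s n t : nat) : (t <= n)%N ->
  count (fun u => (u < s + t) && P u)%N (iota s n) = count P (iota s t).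
Proof.
move=> tn; rewrite -(subnKC tn) iotaD count_cat [X in (_ + X)%N](_ : _ = 0%N).
  rewrite addn0; apply: eq_in_count => u; rewrite mem_iota => /andP[_ ->].
  by [].
rewrite -(count_pred0 (iota (s + t) (n - t))).
apply: eq_in_count => u; rewrite mem_iota => /andP[su _].
by rewrite ltnNge su.
Qed.

(** Only the first [f] hits are preceded by fewer than [f] hits. With [P] membership in a group and
    [f] its floor, these are the pulls made while the deficit is positive. *)
Lemma count_unmet (P : pred nat) (s n f : nat) :
  count (fun t => P t && (count (fun u => (u < t) && P u)%N (iota s n) < f)%N)
    (iota s n) = minn f (count P (iota s n)).
Proof.
(* Unlike the original predicate, [Q] does not mention [n], which makes induction on [n]
   possible. *)
pose Q t := P t && (count P (iota s (t - s)) < f)%N.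
transitivity (count Q (iota s n)).
  apply: eq_in_count => t; rewrite mem_iota => /andP[st tn].
  have tsn : (t - s <= n)%N by rewrite leq_subLR ltnW.
  by rewrite /Q -(count_iota_ltn P s n _ tsn) subnKC.
elim: n => [|n IHn]; first by rewrite minn0.
rewrite -addn1 iotaD !count_cat IHn /= /Q addKn !addn0.
case: (P (s + n)) => /=; last by rewrite !addn0.
lia.
Qed.

(** * Linear programming duality for one block *)

Section Duality.
Variables (R : realType) (K : nat) (mu : 'I_K -> R) (G : {set {set 'I_K}}).
Variable b : block K.
Implicit Types (omega : R) (lambda : {set 'I_K} -> R) (y : 'I_K -> R).

Lemma reduced_cost_ge0 omega lambda i :
  dual_feasible mu G omega lambda -> 0 <= reduced_cost mu G omega lambda i.
Proof. by move=> [_ /(_ i)]; rewrite /reduced_cost; lra. Qed.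

Lemma contribution_ge0 omega lambda (A : nat -> 'I_K) tau :
  dual_feasible mu G omega lambda ->
  0 <= contribution mu G b omega lambda A tau.
Proof.
move=> dual; rewrite addr_ge0 ?reduced_cost_ge0 //.
by apply: sumr_ge0 => g /andP[gG _]; apply: dual.1.
Qed.

(** Exchanging the sums over arms and groups cancels the price terms. For feasible pairs both sums
    on the right are nonnegative, which yields weak duality and complementary slackness. *)
Lemma duality_gap omega lambda y : \sum_i y i = (blk_len b)%:R ->
  dual_objective G b omega lambda - frac_objective mu y
  = \sum_i y i * reduced_cost mu G omega lambda i
    + \sum_(g in G) lambda g * (\sum_(i in g) y i - (blk_floor b g)%:R).
Proof.
move=> sum_y.
have -> : \sum_i y i * reduced_cost mu G omega lambda i
        = omega * (blk_len b)%:R - frac_objective mu y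
          - \sum_i y i * \sum_(g in G | i \in g) lambda g.
  rewrite -sum_y mulr_sumr -!sumrB; apply: eq_bigr => i _.
  by rewrite /reduced_cost; ring.
have -> : \sum_(g in G) lambda g * (\sum_(i in g) y i - (blk_floor b g)%:R)
        = \sum_i y i * (\sum_(g in G | i \in g) lambda g)
          - \sum_(g in G) (blk_floor b g)%:R * lambda g.
  transitivity (\sum_(g in G) \sum_(i in g) y i * lambda g
                - \sum_(g in G) (blk_floor b g)%:R * lambda g).
    rewrite -sumrB; apply: eq_bigr => g _.
    by rewrite mulrBr mulr_sumr mulrC; congr (_ - _); apply: eq_bigr => i _;
       rewrite mulrC.
  congr (_ - _); rewrite (exchange_big_dep predT) //=.
  by apply: eq_bigr => i _; rewrite mulr_sumr.
by rewrite /dual_objective; ring.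
Qed.

Lemma weak_duality omega lambda y : dual_feasible mu G omega lambda ->
  frac_feasible G b y ->
  frac_objective mu y <= dual_objective G b omega lambda.
Proof.
move=> dual [y_ge0 y_floor sum_y].
rewrite -subr_ge0 duality_gap // addr_ge0 // sumr_ge0 // => [i _|g gG].
  by rewrite mulr_ge0 ?reduced_cost_ge0.
by rewrite mulr_ge0 ?subr_ge0 ?y_floor //; apply: dual.1.
Qed.

(* Farkas applied to the homogenized dual program: a point [(w, l, t)] with
   [t > 0] is [t] times a dual feasible point, one with [t = 0] is a recession
   direction of the dual feasible set. *)
Lemma strong_duality omega lambda : dual_optimal mu G b omega lambda ->
  exists2 y, frac_feasible G b y
           & frac_objective mu y = dual_objective G b omega lambda.
Proof.
move=> [dual opt]; have [l_ge0 w_ge] := dual.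
set v := dual_objective G b omega lambda.
pose V : lmodType R := (R^o * {ffun {set 'I_K} -> R^o} * R^o)%type.
(* The three kinds of index stand for [t >= 0], the homogenized dual constraint of an arm, and the
   sign of a price. *)
pose a (j : (unit + ('I_K + {set 'I_K}))%type) (x : V) : R :=
  match j with
  | inl _ => x.2
  | inr (inl i) => x.1.1 - \sum_(g in G | i \in g) x.1.2 g - mu i * x.2
  | inr (inr g) => x.1.2 g
  end.
pose c (x : V) : R := dual_objective G b x.1.1 x.1.2 - v * x.2.
have sum_lin (P : pred {set 'I_K}) (h : {set 'I_K} -> R) k (x z : V) :
    \sum_(g | P g) h g * (k *: x + z).1.2 g
    = k * (\sum_(g | P g) h g * x.1.2 g) + \sum_(g | P g) h g * z.1.2 g.
  rewrite mulr_sumr -big_split; apply: eq_bigr => g _ /=.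
  by rewrite !ffunE /= /GRing.scale /=; ring.
have mul1 (P : pred {set 'I_K}) (u : {set 'I_K} -> R) :
    \sum_(g | P g) 1 * u g = \sum_(g | P g) u g.
  by apply: eq_bigr => g _; rewrite mul1r.
have lin_a j : scalar (a j).
  case: j => [u|[i|g]] k x z; rewrite /a /=.
  - by [].
  - have := sum_lin (fun g => (g \in G) && (i \in g)) (fun=> 1) k x z.
    by rewrite !mul1 => ->; rewrite /GRing.scale /=; ring.
  - by rewrite !ffunE.
have lin_c : scalar c.
  move=> k x z; rewrite /c /dual_objective sum_lin /= /GRing.scale /=.
  by ring.
have [] := @farkas R V _ (index_enum _) a c (index_enum_uniq _) lin_a lin_c.
  move=> x ax; have {}ax j : 0 <= a j x by apply: ax; rewrite mem_index_enum.
  have t_ge0 : 0 <= x.2 := ax (inl tt).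
  have x_ge0 g : 0 <= x.1.2 g := ax (inr (inr g)).
  have x_ge i : 0 <= x.1.1 - \sum_(g in G | i \in g) x.1.2 g - mu i * x.2
    := ax (inr (inl i)).
  (* A recession direction added to the optimum stays feasible, so by optimality it cannot lower the
     objective. *)
  have [t0|t_neq0] := eqVneq (x.2 : R) 0.
    have /opt : dual_feasible mu G (omega + x.1.1) (fun g => lambda g + x.1.2 g).
      split=> [g gG|i]; first by rewrite addr_ge0 ?l_ge0.
      by rewrite big_split /=; have := x_ge i; have := w_ge i; rewrite t0; lra.
    rewrite /c /dual_objective t0 mulr0 subr0.
    under [\sum_(g in G) _ * (_ + _)]eq_bigr do rewrite mulrDr.
    by rewrite big_split /=; lra.
  have t_gt0 : 0 < (x.2 : R) by rewrite lt_def t_neq0.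
  have /opt : dual_feasible mu G (x.1.1 / x.2) (fun g => x.1.2 g / x.2).
    split=> [g gG|i]; first by rewrite divr_ge0.
    by rewrite -mulr_suml -mulrBl ler_pdivlMr //; have := x_ge i; lra.
  rewrite -/v /c /dual_objective => v_le.
  rewrite subr_ge0 -ler_pdivlMr //; apply: le_trans v_le _.
  rewrite mulrBl mulr_suml; under eq_bigr do rewrite mulrA.
  by rewrite mulrAC.
move=> z z_ge0 cE.
have {}cE x : c x = z (inl tt) * a (inl tt) x
    + (\sum_i z (inr (inl i)) * a (inr (inl i)) x
       + \sum_g z (inr (inr g)) * a (inr (inr g)) x).
  by rewrite cE !big_sumType /= (big_pred1 tt) // => -[].
(* The Farkas multipliers of the arm constraints form the primal plan. Evaluating [cE] at unit
   vectors reads off its properties: the [omega] coordinate gives the total. *)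
pose y i := z (inr (inl i)).
have sum_y : \sum_i y i = (blk_len b)%:R.
  have := cE (1, 0, 0); rewrite /c /a /dual_objective /= !mulr0 subr0 mul1r add0r.
  under eq_bigr do rewrite ffunE mulr0.
  rewrite big1_eq subr0 => ->.
  rewrite [X in _ + X]big1 ?addr0 => [|g _]; last by rewrite ffunE mulr0.
  apply: eq_bigr => i _; rewrite big1 ?mulr0 ?subr0 ?mulr1 // => g _.
  by rewrite ffunE.
have y_floor g : g \in G -> (blk_floor b g)%:R <= \sum_(i in g) y i.
  (* The price coordinate of [g] identifies the surplus over the floor with the multiplier of its
     sign constraint. *)
  move=> gG; have := cE (0, [ffun h => (h == g)%:R], 0).
  rewrite /c /a /dual_objective /= !mulr0 subr0 mul0r !add0r.
  rewrite (bigD1 g) //= ffunE eqxx mulr1 big1 ?addr0 => [|h /andP[_ /negPf hg]];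
    last by rewrite ffunE hg mulr0.
  rewrite [X in _ = _ + X -> _](bigD1 g) //= ffunE eqxx mulr1.
  rewrite [X in _ = _ + (_ + X) -> _]big1 ?addr0 => [|h /negPf hg]; last first.
    by rewrite ffunE hg mulr0.
  have -> : \sum_i y i * (0 - \sum_(h in G | i \in h)
              [ffun h => (h == g)%:R : R^o] h - mu i * 0)
          = - \sum_(i in g) y i.
    rewrite -sumrN [RHS]big_mkcond; apply: eq_bigr => i _.
    rewrite mulr0 subr0 sub0r mulrN; case: ifPn => ig.
      rewrite (bigD1 g) ?gG //= ffunE eqxx big1 ?addr0 ?mulr1 // => h.
      by move=> /andP[_ /negPf hg]; rewrite ffunE hg.
    rewrite big1 ?mulr0 ?oppr0 // => h /andP[_ ih]; rewrite ffunE.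
    by case: eqP => // hg; rewrite -hg ih in ig.
  by have := z_ge0 (inr (inr g)); lra.
have obj_ge : v <= frac_objective mu y.
  (* The [t] coordinate gives [frac_objective mu y - v] as the multiplier of [t >= 0]. *)
  have := cE (0, 0, 1); rewrite /c /a /dual_objective /= mul0r !mulr1 sub0r.
  under eq_bigr do rewrite ffunE mulr0.
  rewrite big1_eq oppr0 add0r.
  rewrite [X in _ + (_ + X)]big1 ?addr0 => [|g _]; last by rewrite ffunE mulr0.
  have -> : \sum_i y i * (0 - \sum_(g in G | i \in g)
              (0 : {ffun {set 'I_K} -> R^o}) g - mu i * 1)
          = - frac_objective mu y.
    rewrite -sumrN; apply: eq_bigr => i _.
    by rewrite big1 => [|g _]; rewrite ?ffunE //; ring.
  by have := z_ge0 (inl tt); lra.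
have feas : frac_feasible G b y by split=> // i; apply: z_ge0.
by exists y => //; apply/eqP; rewrite eq_le obj_ge weak_duality.
Qed.

Lemma set_maxE (S : set R) (v : R) :
  S v -> (forall w, S w -> w <= v) -> set_max S = v.
Proof.
move=> Sv ub_v; rewrite /set_max; case: xgetP => [w _ [Sw ub_w]|/(_ v)[]].
  by apply/eqP; rewrite eq_le ub_v // ub_w.
by split.
Qed.

Lemma frac_value_opt omega lambda : dual_optimal mu G b omega lambda ->
  frac_value mu G b = dual_objective G b omega lambda.
Proof.
move=> opt; have [y y_feas yE] := strong_duality _ _ opt.
apply: set_maxE => [|_ [z z_feas <-]]; first by exists y.
exact: weak_duality opt.1 z_feas.
Qed.

(** The sign hypothesis covers the default value 0 of [set_max]. *)
Lemma frac_value_le omega lambda : dual_feasible mu G omega lambda ->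
  0 <= dual_objective G b omega lambda ->
  frac_value mu G b <= dual_objective G b omega lambda.
Proof.
move=> dual dual_ge0; rewrite /frac_value /set_max.
by case: xgetP => [_ _ [[z z_feas <-] _]|//]; apply: weak_duality.
Qed.

(** Complementary slackness: strong duality makes the gap of [y] zero, so each nonnegative term
    [y j * reduced_cost mu G omega lambda j] vanishes. *)
Lemma optimal_support_reduced_cost omega lambda y i :
  dual_optimal mu G b omega lambda -> frac_optimal mu G b y ->
  y i != 0 -> reduced_cost mu G omega lambda i = 0.
Proof.
move=> opt [[y_ge0 y_floor sum_y] y_opt] yi0; have dual := opt.1.
have [z z_feas zE] := strong_duality _ _ opt.
have cost_ge0 j : 0 <= y j * reduced_cost mu G omega lambda j.
  by rewrite mulr_ge0 ?reduced_cost_ge0.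
have slack_ge0 :
    0 <= \sum_(g in G) lambda g * (\sum_(j in g) y j - (blk_floor b g)%:R).
  by apply: sumr_ge0 => g gG; rewrite mulr_ge0 ?subr_ge0 ?y_floor ?dual.1.
have cost0 : \sum_j y j * reduced_cost mu G omega lambda j = 0.
  apply/eqP; rewrite eq_le sumr_ge0 // andbT.
  by have := duality_gap omega lambda y sum_y; have := y_opt z z_feas; lra.
move/eqP: cost0; rewrite psumr_eq0 // => /allP/(_ i (mem_index_enum i)) /=.
by rewrite mulf_eq0 (negPf yi0) => /eqP.
Qed.

(* At each pull the two summands add up to [omega] minus the prices of the pulled
   groups with positive deficit, and a fair sequence makes exactly
   [blk_floor b g] pulls of [g] while its deficit is positive. *)
Lemma fair_pulls_dual_objective omega lambda (A : nat -> 'I_K) :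
  (forall g : {set 'I_K}, g \in G ->
    (blk_floor b g <= count (fun t => A t \in g) (rounds b))%N) ->
  \sum_(tau <- rounds b) mu (A tau)
    + \sum_(tau <- rounds b) contribution mu G b omega lambda A tau
  = dual_objective G b omega lambda.
Proof.
move=> fair.
pose unmet (g : {set 'I_K}) tau := (A tau \in g) && (deficit b A g tau != 0%N).
rewrite -big_split /=.
transitivity (\sum_(tau <- rounds b)
                (omega - \sum_(g in G | unmet g tau) lambda g)).
  apply: eq_bigr => tau _; rewrite /contribution /reduced_cost.
  (* The prices of the pulled groups are split by whether the deficit is zero; the zero part cancels
     against the second summand of the contribution. *)
  rewrite [\sum_(g in G | A tau \in g) _]
    (bigID (fun g => deficit b A g tau == 0%N)) /=.
  have assoc (Q : pred {set 'I_K}) :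
      \sum_(g in G | (A tau \in g) && Q g) lambda g
      = \sum_(g | (g \in G) && (A tau \in g) && Q g) lambda g.
    by apply: eq_bigl => g; rewrite andbA.
  by rewrite !assoc; ring.
rewrite sumrB /dual_objective; congr (_ - _).
  by rewrite big_const_seq count_predT size_iota addKn iter_addr_0 mulr_natr.
rewrite (exchange_big_dep (mem G)) /= => [|tau g _ /andP[] //].
apply: eq_bigr => g gG; rewrite -big_filter big_const_seq count_predT.
rewrite iter_addr_0 size_filter mulr_natl; congr (_ *+ _).
(* Fairness turns the minimum in [count_unmet] into the floor itself. *)
rewrite -(minn_idPl (fair g gG)) /rounds /index_iota addKn -count_unmet.
apply: eq_count => tau; rewrite gG /unmet /deficit /rounds /index_iota addKn.
by rewrite subn_eq0 -ltnNge.
Qed.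

End Duality.

Theorem proposition24 (R : realType) (K B : nat) (mu : 'I_K -> R)
    (hmu : forall i, 0 <= mu i <= 1)
    (G : {set {set 'I_K}}) (blk : 'I_B -> block K) (b : 'I_B)
    (omega : R) (lambda : {set 'I_K} -> R)
    (hdual : dual_feasible mu G omega lambda) :
  [/\ forall i, 0 <= reduced_cost mu G omega lambda i,
      forall A : nat -> 'I_K, blockwise_group_fair G blk A ->
        frac_value mu G (blk b) - \sum_(tau <- rounds (blk b)) mu (A tau)
        <= \sum_(tau <- rounds (blk b))
             contribution mu G (blk b) omega lambda A tau,
      dual_optimal mu G (blk b) omega lambda ->
        (forall A : nat -> 'I_K, blockwise_group_fair G blk A ->
           frac_value mu G (blk b) - \sum_(tau <- rounds (blk b)) mu (A tau)
           = \sum_(tau <- rounds (blk b))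
               contribution mu G (blk b) omega lambda A tau) /\
        (forall y : 'I_K -> R, frac_optimal mu G (blk b) y ->
           forall i, y i != 0 -> reduced_cost mu G omega lambda i = 0)
    & forall (A : nat -> 'I_K) (tau : nat), tau \in rounds (blk b) ->
        0 <= contribution mu G (blk b) omega lambda A tau].
Proof.
have contr_ge0 A tau := contribution_ge0 _ _ mu G (blk b) omega lambda A tau hdual.
split=> [i|A fair|opt|A tau _ //]; first exact: reduced_cost_ge0.
  rewrite lerBlDl (fair_pulls_dual_objective _ _ _ _ _ _ _ _ (fair b)).
  apply: frac_value_le => //.
  (* The dual objective is nonnegative, being a sum of means and contributions along the fair
     sequence. *)
  rewrite -(fair_pulls_dual_objective _ _ mu _ _ _ _ _ (fair b)).
  rewrite addr_ge0 // sumr_ge0 // => tau _; by case/andP: (hmu (A tau)).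
split=> [A fair|y y_opt i]; last exact: optimal_support_reduced_cost opt y_opt.
rewrite (frac_value_opt _ _ _ _ _ _ _ opt).
by rewrite -(fair_pulls_dual_objective _ _ mu _ _ _ _ _ (fair b)) addrC addKr.
Qed.
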